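(* Let $f_E\colon E\to\mathcal FE$ be an $\mathcal F$-system in a monoidal setting for dynamic stability. Let $V\colon E\to R$ be a morphism in $\mathcal C$ that is positive definite with respect to an equilibrium point $x^*\colon 1\to E$, and suppose that $$\mathcal FV\circ f_E\le 0_R\circ V\quad\text{in }\mathcal C(E,\mathcal FR).$$ Then $V$ is a Lyapunov morphism (with equilibrium point $x^*$) for every solution flow $\phi\colon T\times E\to E$ of $f_E$ having $x^*$ as an equilibrium point. Therefore $x^*$ is a stable equilibrium point if a solution flow exists (stable for every such solution flow).
   Context: Conventions. $\mathcal C$ is a category with all finite products and terminal object $1$; $!\colon X\to 1$ is the unique map; $\langle a,b\rangle$ denotes pairing; $\pi$ denotes a product projection. $\mathcal F\colon\mathcal C\to\mathcal C$ is an endofunctor. An $\mathcal F$-system is a morphism $f\colon X\to\mathcal FX$; a morphism of $\mathcal F$-systems from $f\colon X\to\mathcal FX$ to $g\colon Y\to\mathcal FY$ is $p\colon X\to Y$ with $\mathcal Fp\circ f=g\circ p$. An object $R$ is posetal if every hom-set $\mathcal C(A,R)$ carries a partial order $\le$ such that precomposition with any $A'\to A$ is order-preserving. Monoidal setting for dynamic stability. It consists of: an object $E$; a monoid object $(T,\oplus,0_\oplus)$; a posetal object $R$ with a point $o_R\colon 1\to R$; a morphism $d\colon E\times E\to R$ with $d\ge o_R\circ !$ and such that the diagonal $\Delta\colon E\to E\times E$ is the equalizer of $d$ and $o_R\circ !$; an $\mathcal F$-system $1_T\colon T\to\mathcal FT$ (unit clock); a posetal structure on $\mathcal FR$; a natural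 transformation $\psi_{A,B}\colon\mathcal FA\times\mathcal FB\to\mathcal F(A\times B)$ that is associative, i.e. $\mathcal F\alpha_{X,Y,Z}\circ\psi_{X\times Y,Z}\circ(\psi_{X,Y}\times\mathrm{id})=\psi_{X,Y\times Z}\circ(\mathrm{id}\times\psi_{Y,Z})\circ\alpha_{\mathcal FX,\mathcal FY,\mathcal FZ}$ with $\alpha$ the associativity isomorphism of products; a natural transformation $0_A\colon A\to\mathcal FA$ (stationary systems) with $\psi_{A,B}\circ(0_A\times 0_B)=0_{A\times B}$; the stable system on $R$ is $\sigma=0_R\colon R\to\mathcal FR$. For an object $X$ put $\mathcal L_X:=\psi_{T,X}\circ(1_T\times 0_X)\colon T\times X\to\mathcal F(T\times X)$. These are subject to the comparison axioms: (D4) for every $\gamma\colon T\to R$, $\mathcal F\gamma\circ 1_T\le\sigma\circ\gamma$ implies $\gamma\le\gamma\circ 0_\oplus\circ !$; (D4') for every object $A$ and every $\gamma\colon T\times A\to R$, $\mathcal F\gamma\circ\mathcal L_A\le 0_R\circ\gamma$ implies $\gamma\le\gamma\circ\langle 0_\oplus\circ !,\mathrm{id}_A\rangle\circ\pi_A$. Flows. A $T$-flow on $E$ is a monoid action $\phi\colon T\times E\to E$: $\phi\circ\langle 0_\oplus\circ !,\mathrm{id}_E\rangle=\mathrm{id}_E$ and $\phi\circ(\oplus\times\mathrm{id}_E)=\phi\circ(\mathrm{id}_T\times\phi)$. A solution flow of $f_E$ is a $T$-flow $\phi$ on $E$ that is a morphism of systems $\mathcal L_E\to f_E$, i.e. $\mathcal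 F\phi\circ\mathcal L_E=f_E\circ\phi$. A point $x^*\colon 1\to E$ is an equilibrium point of $\phi$ if $\phi\circ\langle\mathrm{id}_T,x^*\circ !\rangle=x^*\circ !\colon T\to E$. Stability. $\|\cdot\|_{x^*}:=d\circ\langle\mathrm{id}_E,x^*\circ !\rangle\colon E\to R$. A morphism $\alpha\colon R\to R$ is class $\mathcal K$ if it is order-preserving (postcomposition with $\alpha$ is order-preserving on each $\mathcal C(A,R)$), has an order-preserving inverse, and $\alpha\circ o_R=o_R$. $V\colon E\to R$ is positive definite with respect to $x^*$ if there are class $\mathcal K$ morphisms $\underline\alpha,\overline\alpha$ with $\underline\alpha\circ\|\cdot\|_{x^*}\le V\le\overline\alpha\circ\|\cdot\|_{x^*}$. The equilibrium point $x^*$ is stable for $\phi$ if there is a class $\mathcal K$ morphism $\alpha$ with $\|\cdot\|_{x^*}\circ\phi\le\alpha\circ\|\cdot\|_{x^*}\circ\pi_E$. A Lyapunov morphism for $\phi$ with equilibrium point $x^*$ is a positive definite $V\colon E\to R$ with $V\circ\phi\le V\circ\pi_E$ in $\mathcal C(T\times E,R)$. *)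

(* Defs.v *)
From Stdlib Require Import Relations.

Set Implicit Arguments.
Unset Strict Implicit.
Unset Printing Implicit Defensive.

Declare Scope cat_scope.
Delimit Scope cat_scope with cat.
Local Open Scope cat_scope.

Record category := Category {
  obj :> Type;
  hom : obj -> obj -> Type;
  idm : forall X, hom X X;
  comp : forall X Y Z, hom Y Z -> hom X Y -> hom X Z;
  comp_id_l : forall X Y (f : hom X Y), comp (idm Y) f = f;
  comp_id_r : forall X Y (f : hom X Y), comp f (idm X) = f;
  comp_assoc : forall X Y Z W (h : hom Z W) (g : hom Y Z) (f : hom X Y),
    comp h (comp g f) = comp (comp h g) f
}.

Arguments hom {c} _ _.
Arguments idm {c} _.
Arguments comp {c X Y Z} _ _.

Notation "g ∘ f" := (comp g f) (at level 40, left associativity) : cat_scope.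

(* All finite products, given by a chosen terminal object and chosen binary
   products. *)
Record cartesian_category := CartesianCategory {
  ccat :> category;
  term : ccat;
  bang : forall X : ccat, hom X term;
  bang_unique : forall (X : ccat) (f : hom X term), f = bang X;
  prod : ccat -> ccat -> ccat;
  pr1 : forall X Y : ccat, hom (prod X Y) X;
  pr2 : forall X Y : ccat, hom (prod X Y) Y;
  pair : forall A X Y : ccat, hom A X -> hom A Y -> hom A (prod X Y);
  pr1_pair : forall (A X Y : ccat) (f : hom A X) (g : hom A Y),
    comp (pr1 X Y) (pair f g) = f;
  pr2_pair : forall (A X Y : ccat) (f : hom A X) (g : hom A Y),
    comp (pr2 X Y) (pair f g) = g;
  pair_unique : forall (A X Y : ccat) (f : hom A X) (g : hom A Y)
      (h : hom A (prod X Y)),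
    comp (pr1 X Y) h = f -> comp (pr2 X Y) h = g -> h = pair f g
}.

Arguments term {c}.
Arguments bang {c} X.
Arguments prod {c} _ _.
Arguments pr1 {c} X Y.
Arguments pr2 {c} X Y.
Arguments pair {c A X Y} _ _.

Notation "X × Y" := (prod X Y) (at level 35, right associativity) : cat_scope.
Notation "⟨ f , g ⟩" := (pair f g)
  (at level 0, f at level 99, g at level 99) : cat_scope.

Definition prod_map (C : cartesian_category) (X Y X' Y' : C)
    (f : hom X X') (g : hom Y Y') : hom (X × Y) (X' × Y') :=
  ⟨f ∘ pr1 X Y, g ∘ pr2 X Y⟩.

Notation "f ⊗ g" := (prod_map f g) (at level 35, right associativity) : cat_scope.

Definition prod_assoc (C : cartesian_category) (X Y Z : C) :
    hom ((X × Y) × Z) (X × (Y × Z)) :=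
  ⟨pr1 X Y ∘ pr1 (X × Y) Z, ⟨pr2 X Y ∘ pr1 (X × Y) Z, pr2 (X × Y) Z⟩⟩.

Arguments prod_assoc {C} X Y Z.

Definition diag (C : cartesian_category) (X : C) : hom X (X × X) :=
  ⟨idm X, idm X⟩.

Arguments diag {C} X.

(* The constant generalized element [A -> 1 -> X]. *)
Definition const (C : cartesian_category) (A X : C) (x : hom term X) :
    hom A X :=
  x ∘ bang A.

Arguments const {C} A {X} x.

Definition is_equalizer (C : category) (K X Y : C) (e : hom K X)
    (f g : hom X Y) : Prop :=
  f ∘ e = g ∘ e /\
  forall (A : C) (h : hom A X), f ∘ h = g ∘ h -> exists! k : hom A K, e ∘ k = h.

Record endofunctor (C : category) := Endofunctor {
  fobj :> C -> C;
  fmap : forall X Y : C, hom X Y -> hom (fobj X) (fobj Y);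
  fmap_id : forall X : C, fmap (idm X) = idm (fobj X);
  fmap_comp : forall (X Y Z : C) (g : hom Y Z) (f : hom X Y),
    fmap (g ∘ f) = fmap g ∘ fmap f
}.

Arguments fmap {C} e {X Y} _.

Definition fsystem (C : category) (F : endofunctor C) (X : C) : Type :=
  hom X (F X).

Definition is_system_morphism (C : category) (F : endofunctor C) (X Y : C)
    (f : fsystem F X) (g : fsystem F Y) (p : hom X Y) : Prop :=
  fmap F p ∘ f = g ∘ p.

Record posetal (C : category) (R : C) := Posetal {
  ple : forall A : C, hom A R -> hom A R -> Prop;
  ple_order : forall A : C, order (hom A R) (@ple A);
  ple_precomp : forall (A A' : C) (h : hom A' A) (f g : hom A R),
    ple f g -> ple (f ∘ h) (g ∘ h)
}.

Arguments ple {C R} p {A} _ _.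

Notation "f ≤[ P ] g" := (ple P f g)
  (at level 70, no associativity) : cat_scope.

Record monoid_object (C : cartesian_category) := MonoidObject {
  mcarrier :> C;
  madd : hom (mcarrier × mcarrier) mcarrier;
  mzero : hom term mcarrier;
  madd_assoc :
    madd ∘ (madd ⊗ idm mcarrier) =
    madd ∘ (idm mcarrier ⊗ madd) ∘ prod_assoc mcarrier mcarrier mcarrier;
  madd_zero_l : madd ∘ ⟨const mcarrier mzero, idm mcarrier⟩ = idm mcarrier;
  madd_zero_r : madd ∘ ⟨idm mcarrier, const mcarrier mzero⟩ = idm mcarrier
}.

Arguments madd {C} m.
Arguments mzero {C} m.

Record stability_setting (C : cartesian_category) (F : endofunctor C) :=
StabilitySetting {
  sE : C;
  sT : monoid_object C;
  sR : C;
  leR : posetal sR;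
  oR : hom term sR;
  dist : hom (sE × sE) sR;
  dist_ge : const (sE × sE) oR ≤[leR] dist;
  dist_equalizer : is_equalizer (diag sE) dist (const (sE × sE) oR);
  clock : fsystem F sT;
  leFR : posetal (F sR);
  psi : forall A B : C, hom (F A × F B) (F (A × B));
  psi_natural : forall (A B A' B' : C) (f : hom A A') (g : hom B B'),
    fmap F (f ⊗ g) ∘ psi A B = psi A' B' ∘ (fmap F f ⊗ fmap F g);
  psi_assoc : forall X Y Z : C,
    fmap F (prod_assoc X Y Z) ∘ psi (X × Y) Z ∘ (psi X Y ⊗ idm (F Z)) =
    psi X (Y × Z) ∘ (idm (F X) ⊗ psi Y Z) ∘ prod_assoc (F X) (F Y) (F Z);
  stat : forall A : C, fsystem F A;
  stat_natural : forall (A B : C) (f : hom A B),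
    fmap F f ∘ stat A = stat B ∘ f;
  psi_stat : forall A B : C, psi A B ∘ (stat A ⊗ stat B) = stat (A × B);
  comparison : forall gamma : hom sT sR,
    fmap F gamma ∘ clock ≤[leFR] stat sR ∘ gamma ->
    gamma ≤[leR] gamma ∘ const sT (mzero sT);
  (* [psi sT A ∘ (clock ⊗ stat A)] is [lift_clock] below. *)
  comparison_param : forall (A : C) (gamma : hom (sT × A) sR),
    fmap F gamma ∘ (psi sT A ∘ (clock ⊗ stat A)) ≤[leFR] stat sR ∘ gamma ->
    gamma ≤[leR] gamma ∘ ⟨const A (mzero sT), idm A⟩ ∘ pr2 sT A
}.

Arguments sE {C F} s.
Arguments sT {C F} s.
Arguments sR {C F} s.
Arguments leR {C F} s.
Arguments oR {C F} s.
Arguments dist {C F} s.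
Arguments clock {C F} s.
Arguments leFR {C F} s.
Arguments psi {C F} s A B.
Arguments stat {C F} s A.

Definition lift_clock (C : cartesian_category) (F : endofunctor C)
    (S : stability_setting F) (X : C) : fsystem F (sT S × X) :=
  psi S (sT S) X ∘ (clock S ⊗ stat S X).

Definition is_flow (C : cartesian_category) (T : monoid_object C) (E : C)
    (phi : hom (T × E) E) : Prop :=
  phi ∘ ⟨const E (mzero T), idm E⟩ = idm E /\
  phi ∘ (madd T ⊗ idm E) = phi ∘ (idm T ⊗ phi) ∘ prod_assoc T T E.

Definition is_solution_flow (C : cartesian_category) (F : endofunctor C)
    (S : stability_setting F) (fE : fsystem F (sE S))
    (phi : hom (sT S × sE S) (sE S)) : Prop :=
  is_flow phi /\ is_system_morphism (lift_clock S (sE S)) fE phi.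

Definition is_equilibrium (C : cartesian_category) (T E : C)
    (phi : hom (T × E) E) (x : hom term E) : Prop :=
  phi ∘ ⟨idm T, const T x⟩ = const T x.

Definition dist_to (C : cartesian_category) (F : endofunctor C)
    (S : stability_setting F) (x : hom term (sE S)) : hom (sE S) (sR S) :=
  dist S ∘ ⟨idm (sE S), const (sE S) x⟩.

Definition order_preserving (C : category) (R : C) (P : posetal R)
    (alpha : hom R R) : Prop :=
  forall (A : C) (f g : hom A R), f ≤[P] g -> alpha ∘ f ≤[P] alpha ∘ g.

Definition class_K (C : cartesian_category) (F : endofunctor C)
    (S : stability_setting F) (alpha : hom (sR S) (sR S)) : Prop :=
  order_preserving (leR S) alpha /\
  (exists beta : hom (sR S) (sR S),
     order_preserving (leR S) beta /\
     alpha ∘ beta = idm (sR S) /\ beta ∘ alpha = idm (sR S)) /\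
  alpha ∘ oR S = oR S.

Definition positive_definite (C : cartesian_category) (F : endofunctor C)
    (S : stability_setting F) (x : hom term (sE S)) (V : hom (sE S) (sR S)) :
    Prop :=
  exists alpha_lo alpha_hi : hom (sR S) (sR S),
    class_K alpha_lo /\ class_K alpha_hi /\
    alpha_lo ∘ dist_to x ≤[leR S] V /\ V ≤[leR S] alpha_hi ∘ dist_to x.

Definition is_stable_equilibrium (C : cartesian_category) (F : endofunctor C)
    (S : stability_setting F) (phi : hom (sT S × sE S) (sE S))
    (x : hom term (sE S)) : Prop :=
  is_equilibrium phi x /\
  exists alpha : hom (sR S) (sR S),
    class_K alpha /\
    dist_to x ∘ phi ≤[leR S] alpha ∘ dist_to x ∘ pr2 (sT S) (sE S).

Definition is_lyapunov (C : cartesian_category) (F : endofunctor C)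
    (S : stability_setting F) (phi : hom (sT S × sE S) (sE S))
    (x : hom term (sE S)) (V : hom (sE S) (sR S)) : Prop :=
  is_equilibrium phi x /\
  positive_definite x V /\
  V ∘ phi ≤[leR S] V ∘ pr2 (sT S) (sE S).

(* Main.v *)
(** The decrease condition [F V ∘ fE ≤ 0_R ∘ V], precomposed with a solution
    flow [phi], says that [V ∘ phi] satisfies the hypothesis of the parametric
    comparison axiom; that axiom bounds [V ∘ phi] by its value at time zero,
    which is [V].  Stability follows by sandwiching [V] between
    [alpha_lo ∘ dist_to x] and [alpha_hi ∘ dist_to x] and inverting [alpha_lo]. *)

Require Import Defs.
Set Implicit Arguments.
Local Open Scope cat_scope.

Lemma ple_trans (C : category) (R : C) (P : posetal R) (A : C)
    (f g h : hom A R) :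
  f ≤[P] g -> g ≤[P] h -> f ≤[P] h.
Proof. destruct (ple_order P A) as [_ trans _]; apply trans. Qed.

Lemma class_K_comp (C : cartesian_category) (F : endofunctor C)
    (S : stability_setting F) (a b : hom (sR S) (sR S)) :
  class_K a -> class_K b -> class_K (a ∘ b).
Proof.
intros [a_mono [[a' [a'_mono [aa' a'a]]] a0]]
       [b_mono [[b' [b'_mono [bb' b'b]]] b0]].
split; [|split].
- intros A f g fg; rewrite <- !comp_assoc; auto.
- exists (b' ∘ a'); split; [|split].
  + intros A f g fg; rewrite <- !comp_assoc; auto.
  + rewrite comp_assoc, <- (comp_assoc a b b'), bb', comp_id_r; exact aa'.
  + rewrite comp_assoc, <- (comp_assoc b' a' a), a'a, comp_id_r; exact b'b.
- rewrite <- comp_assoc, b0; exact a0.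
Qed.

(** The inverse [b] fixes the base point because [a] does: [b ∘ oR S = b ∘ a ∘ oR S = oR S]. *)
Lemma class_K_inverse (C : cartesian_category) (F : endofunctor C)
    (S : stability_setting F) (a : hom (sR S) (sR S)) :
  class_K a -> exists b, class_K b /\ b ∘ a = idm (sR S).
Proof.
intros [a_mono [[b [b_mono [ab ba]]] a0]].
exists b; split; [|exact ba].
split; [exact b_mono|split].
- now exists a.
- transitivity (b ∘ (a ∘ oR S)); [now rewrite a0|].
  now rewrite comp_assoc, ba, comp_id_l.
Qed.

Lemma solution_flow_decr (C : cartesian_category) (F : endofunctor C)
    (S : stability_setting F) (fE : fsystem F (sE S))
    (V : hom (sE S) (sR S)) (phi : hom (sT S × sE S) (sE S)) :
  fmap F V ∘ fE ≤[leFR S] stat S (sR S) ∘ V ->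
  is_solution_flow fE phi ->
  V ∘ phi ≤[leR S] V ∘ pr2 (sT S) (sE S).
Proof.
intros V_decr [[phi0 _] phi_sol].
assert (H : fmap F (V ∘ phi) ∘ lift_clock S (sE S)
            ≤[leFR S] stat S (sR S) ∘ (V ∘ phi)).
(* Since [phi] is a system morphism, [fmap F phi ∘ lift_clock S (sE S)] becomes [fE ∘ phi]. *)
{ rewrite fmap_comp, <- comp_assoc, phi_sol, !comp_assoc.
  now apply ple_precomp. }
(* The axiom matches [H] once [lift_clock] is unfolded; the flow's unit law then reduces [phi] at
   time zero to the identity. *)
apply comparison_param in H.
now rewrite <- (comp_assoc V phi), phi0, comp_id_r in H.
Qed.

Lemma lyapunov_stable (C : cartesian_category) (F : endofunctor C)
    (S : stability_setting F) (phi : hom (sT S × sE S) (sE S))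
    (x : hom term (sE S)) (V : hom (sE S) (sR S)) :
  is_lyapunov phi x V -> is_stable_equilibrium phi x.
Proof.
intros [phi_eq [[lo [hi [lo_K [hi_K [lo_V V_hi]]]]] V_phi]].
split; [exact phi_eq|].
destruct (class_K_inverse lo_K) as [b [b_K b_lo]].
(* With [b] inverse to [lo], the gain [b ∘ hi] comes from solving [lo ∘ dist_to x ∘ phi ≤ hi ∘
   dist_to x ∘ pr2] for the distance. *)
exists (b ∘ hi); split; [now apply class_K_comp|].
(* Inserting [b ∘ lo] for the identity puts [b] outermost on both sides, so its monotonicity removes
   it. *)
rewrite <- (comp_id_l (dist_to x ∘ phi)), <- b_lo, <- !comp_assoc.
apply (proj1 b_K).
rewrite !comp_assoc.
apply ple_trans with (V ∘ phi); [now apply ple_precomp|].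
apply ple_trans with (V ∘ pr2 (sT S) (sE S)); [exact V_phi|].
now apply ple_precomp.
Qed.

Theorem theorem5p10 (C : cartesian_category) (F : endofunctor C)
    (S : stability_setting F) (fE : fsystem F (sE S))
    (x : hom term (sE S)) (V : hom (sE S) (sR S))
    (V_posdef : positive_definite x V)
    (V_decr : fmap F V ∘ fE ≤[leFR S] stat S (sR S) ∘ V) :
  (forall phi : hom (sT S × sE S) (sE S),
     is_solution_flow fE phi -> is_equilibrium phi x ->
     is_lyapunov phi x V) /\
  (forall phi : hom (sT S × sE S) (sE S),
     is_solution_flow fE phi -> is_equilibrium phi x ->
     is_stable_equilibrium phi x).
Proof.
assert (lyap : forall phi : hom (sT S × sE S) (sE S),
  is_solution_flow fE phi -> is_equilibrium phi x -> is_lyapunov phi x V).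
{ intros phi phi_sol phi_eq.
  split; [exact phi_eq|split; [exact V_posdef|]].
  now apply solution_flow_decr with fE. }
split; [exact lyap|].
intros phi phi_sol phi_eq.
exact (lyapunov_stable (lyap phi phi_sol phi_eq)).
Qed.
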